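(* Let $\alpha,\beta\in\mathbb{R}$ with $\beta>0$ and $1<\alpha\le\beta+1$. Let $$V_{\alpha,\beta}(t)=\sum_{p}p^{-\alpha}\cos(2\pi p^{\beta}t),\qquad t\in\mathbb{R},$$ where the sum is over all prime numbers $p$ (it converges absolutely since $\alpha>1$). Then $V_{\alpha,\beta}$ is locally Hölder continuous at every point $t_0\in\mathbb{R}$, and its local Hölder exponent $s$ at $t_0$ satisfies $s\le\frac{\alpha}{\beta}$.
   Context: A function $f:\mathbb{R}\to\mathbb{C}$ is called locally Hölder continuous at $x_0\in\mathbb{R}$ if there exist $s\in(0,1]$ and $C,\epsilon>0$ such that $$|f(x)-f(y)|\le C|x-y|^{s}\quad\text{for all }x,y\in B_{\epsilon}(x_0),$$ where $B_\epsilon(x_0)=(x_0-\epsilon,x_0+\epsilon)$. The supremum of all $s\in(0,1]$ for which such an inequality holds at $x_0$ (for some $C,\epsilon>0$ depending on $s$) is called the local Hölder exponent of $f$ at $x_0$. *)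

(* Defs.v *)
From Stdlib Require Import Reals Lra Lia ZArith Znumtheory.
From Coquelicot Require Import Coquelicot.
Open Scope R_scope.

(** At [x = y] the left-hand side vanishes, so the junk value
    [Rpower 0 s = 1] (instead of [0]) does not affect the condition. *)
Definition holder_at (f : R -> C) (x0 s : R) : Prop :=
  exists K eps : R, 0 < K /\ 0 < eps /\
    forall x y : R, Rabs (x - x0) < eps -> Rabs (y - x0) < eps ->
      Cmod (Cminus (f x) (f y)) <= K * Rpower (Rabs (x - y)) s.

Definition locally_holder (f : R -> C) (x0 : R) : Prop :=
  exists s : R, 0 < s <= 1 /\ holder_at f x0 s.

(** The supremum is taken in [Rbar]; it is a real number in [(0, 1]] exactly
    when [f] is locally Hoelder continuous at [x0], and [m_infty] otherwise. *)
Definition local_holder_exponent (f : R -> C) (x0 : R) : Rbar :=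
  Lub_Rbar (fun s : R => 0 < s <= 1 /\ holder_at f x0 s).

Definition V_term (alpha beta t : R) (n : nat) : R :=
  if prime_dec (Z.of_nat n)
  then Rpower (INR n) (- alpha) * cos (2 * PI * Rpower (INR n) beta * t)
  else 0.

(** The series over all [n : nat] with zero terms at non-primes; it converges
    absolutely for [1 < alpha], see [V_abs_summable]. *)
Definition V (alpha beta t : R) : C := RtoC (Series (V_term alpha beta t)).

Lemma Rpower_neg_telescope (a x : R) :
  0 < a -> 1 < x ->
  Rpower x (- (a + 1)) <= (Rpower (x - 1) (- a) - Rpower x (- a)) / a.
Proof.
intros Ha Hx.
assert (Hpos : 0 < Rpower x (- a)) by apply exp_pos.
assert (Hi : 0 < / x) by (apply Rinv_0_lt_compat; lra).
assert (Hi1 : / x < 1) by (rewrite <- Rinv_1; apply Rinv_lt_contravar; lra).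
assert (E1 : Rpower x (- (a + 1)) = Rpower x (- a) * / x).
{ replace (- (a + 1)) with (- a + Ropp 1) by ring.
  rewrite Rpower_plus, (Rpower_Ropp x 1), Rpower_1 by lra. reflexivity. }
assert (E2 : Rpower (x - 1) (- a) = Rpower x (- a) * Rpower (1 - / x) (- a)).
{ rewrite Rpower_mult_distr by lra. f_equal. field. lra. }
assert (Hln : ln (1 - / x) <= - / x).
{ rewrite <- (ln_exp (- / x)). apply ln_le; [lra|].
  pose proof (exp_ineq1_le (- / x)). lra. }
assert (Hge : 1 + a * / x <= Rpower (1 - / x) (- a)).
{ unfold Rpower. pose proof (exp_ineq1_le (- a * ln (1 - / x))). nra. }
rewrite E1, E2. apply Rmult_le_reg_r with a; [lra|].
match goal with |- _ <= ?e / a * a => replace (e / a * a) with e by (field; lra) end.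
nra.
Qed.

Lemma V_abs_summable (alpha beta t : R) :
  1 < alpha -> ex_series (fun n => Rabs (V_term alpha beta t n)).
Proof.
intros Ha. set (a := alpha - 1).
set (u := fun n => Rabs (V_term alpha beta t n)).
assert (Hz : forall n, (n < 2)%nat -> u n = 0).
{ intros n Hn. unfold u, V_term. destruct (prime_dec _) as [H|H].
  - destruct H. lia.
  - apply Rabs_R0. }
assert (Hu : forall n, u (S (S n)) <=
  (Rpower (INR (S n)) (- a) - Rpower (INR (S (S n))) (- a)) / a).
{ intros n. assert (Hn : 0 <= INR n) by apply pos_INR.
  pose proof (Rpower_neg_telescope a (INR (S (S n)))) as T.
  replace (INR (S (S n)) - 1) with (INR (S n)) in T by (rewrite !S_INR; ring).
  replace (- (a + 1)) with (- alpha) in T by (unfold a; ring).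
  eapply Rle_trans; [|apply T; [unfold a; lra|rewrite !S_INR; lra]].
  unfold u, V_term.
  assert (P : 0 < Rpower (INR (S (S n))) (- alpha)) by apply exp_pos.
  destruct (prime_dec _) as [H|H].
  - rewrite Rabs_mult, (Rabs_right (Rpower _ _)) by lra.
    match goal with |- _ * Rabs (cos ?z) <= _ =>
      assert (Rabs (cos z) <= 1) by (apply Rabs_le, COS_bound) end.
    nra.
  - rewrite Rabs_R0. lra. }
assert (Hs : forall n, sum_n u (S n) <= (1 - Rpower (INR (S n)) (- a)) / a).
{ induction n as [|n IH].
  - rewrite sum_Sn, sum_O, !Hz by lia. unfold plus; simpl.
    unfold Rpower. rewrite ln_1, Rmult_0_r, exp_0. unfold Rdiv. lra.
  - rewrite sum_Sn. unfold plus; simpl (AbelianMonoid.plus _ _ _).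
    specialize (Hu n).
    change (sum_n u (S n) + u (S (S n)) <= (1 - Rpower (INR (S (S n))) (- a)) / a).
    unfold Rdiv in *. nra. }
assert (F : ex_finite_lim_seq (sum_n u)).
{ apply ex_finite_lim_seq_incr with (M := / a).
  - intros n. rewrite sum_Sn. assert (0 <= u (S n)) by apply Rabs_pos.
    change (sum_n u n <= sum_n u n + u (S n)). lra.
  - intros [|n].
    + rewrite sum_O, Hz by lia. left. apply Rinv_0_lt_compat. unfold a; lra.
    + eapply Rle_trans; [apply Hs|].
      assert (0 < Rpower (INR (S n)) (- a)) by apply exp_pos.
      assert (0 < / a) by (apply Rinv_0_lt_compat; unfold a; lra).
      unfold Rdiv. nra. }
destruct F as [l Hl]. exists l. exact Hl.
Qed.

(* Main.v *)
(** Since the exponent never exceeds 1, the upper bound only matters when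
    [alpha < beta], and then [beta > 1], so that the frequencies
    [2 PI n^beta] around [2 PI N^beta] are separated by at least
    [2 PI N^(beta-1)]. Fix a bump [cos^(2k)] supported near [t0]; its Fourier
    transform at [mu] is [O(mu^(-2k))], hence testing
    [V (t + h/2) - V (t - h/2)], with [h] half the period of the frequency of a
    prime [N], against the bump times [sin (2 PI N^beta t)] leaves
    [- c N^(-alpha) + O(N^(-2k (beta-1)))] with [c > 0]. A local Hoelder
    condition of exponent [s] bounds the same integral by
    [O(h^s) = O(N^(- beta s))]; taking [2k (beta-1) > alpha] and letting [N]
    grow forces [s <= alpha / beta]. *)
Require Import Defs.
From Stdlib Require Import Reals Lra Lia ZArith Znumtheory.
From Coquelicot Require Import Coquelicot.
Open Scope R_scope.

(** * Infinitude of the primes *)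

Lemma exists_prime_divisor (n : nat) :
  (1 < n)%nat -> exists p : nat, prime (Z.of_nat p) /\ Nat.divide p n.
Proof.
induction n as [n IH] using (well_founded_induction lt_wf). intros Hn.
destruct (prime_dec (Z.of_nat n)) as [H|H].
- exists n. split; [exact H|apply Nat.divide_refl].
- destruct (not_prime_divide (Z.of_nat n)) as (z & Hz & Hd); [lia|exact H|].
  destruct (IH (Z.to_nat z)) as (p & Hp & Hpz); [lia|lia|].
  exists p. split; [exact Hp|].
  apply Nat.divide_trans with (1 := Hpz).
  destruct Hd as [q Hq]. exists (Z.to_nat q).
  assert (0 <= q)%Z by nia. nia.
Qed.

Lemma divide_fact (d n : nat) : (1 <= d <= n)%nat -> Nat.divide d (fact n).
Proof.
induction n as [|n IH]; intros Hd; [lia|]. simpl fact.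
destruct (Nat.eq_dec d (S n)) as [->|E].
- exists (fact n). lia.
- destruct IH as [q Hq]; [lia|]. exists (S n * q)%nat. simpl. nia.
Qed.

(** Euclid's argument: a prime divisor of [fact m + 1] that is at most [m] also divides [fact m],
    hence divides 1. *)
Lemma exists_prime_above (m : nat) :
  exists p : nat, prime (Z.of_nat p) /\ (m < p)%nat.
Proof.
pose proof (lt_O_fact m) as Hf.
destruct (exists_prime_divisor (fact m + 1)) as (p & Hp & Hd); [lia|].
exists p. split; [exact Hp|].
destruct (Nat.le_gt_cases p m) as [L|L]; [exfalso|exact L].
assert (P : (1 < Z.of_nat p)%Z) by (destruct Hp; assumption).
assert (D : Nat.divide p 1).
{ apply Nat.divide_add_cancel_r with (fact m); [|exact Hd].
  apply divide_fact. lia. }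
apply Nat.divide_1_r in D. lia.
Qed.

(** * Elementary estimates for real powers and the cosine *)

(** Each power splits as [k * k^(b-1)] with a nondecreasing second factor. Whichever of [n] and [m]
    is larger, replacing [n^(b-1)] by [m^(b-1)] only shrinks the distance. The bound involves [m]
    alone, so it separates one chosen frequency from all the others at once. *)
Lemma Rpower_gap (b : R) (n m : nat) :
  1 <= b -> (1 <= n)%nat -> (1 <= m)%nat -> n <> m ->
  Rpower (INR m) (b - 1) <= Rabs (Rpower (INR n) b - Rpower (INR m) b).
Proof.
intros Hb Hn Hm Hnm.
assert (S : forall k, (1 <= k)%nat ->
  0 < INR k /\ 0 < Rpower (INR k) (b - 1) /\
  Rpower (INR k) b = INR k * Rpower (INR k) (b - 1)).
{ intros k Hk. assert (0 < INR k) by (apply lt_0_INR; lia).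
  split; [assumption|]. split; [apply exp_pos|].
  replace b with (1 + (b - 1)) at 1 by ring.
  rewrite Rpower_plus, Rpower_1; trivial. }
destruct (S n Hn) as (n0 & pn & ->), (S m Hm) as (m0 & pm & ->).
destruct (Nat.lt_ge_cases n m) as [L|L].
- assert (INR n + 1 <= INR m) by (rewrite <- S_INR; apply le_INR; lia).
  assert (Rpower (INR n) (b - 1) <= Rpower (INR m) (b - 1))
    by (apply Rle_Rpower_l; lra).
  rewrite Rabs_left1; nra.
- assert (INR m + 1 <= INR n) by (rewrite <- S_INR; apply le_INR; lia).
  assert (Rpower (INR m) (b - 1) <= Rpower (INR n) (b - 1))
    by (apply Rle_Rpower_l; lra).
  rewrite Rabs_right; nra.
Qed.

Lemma Rpower_neg_eventually_small (c e d : R) :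
  0 <= c -> e < 0 -> 0 < d ->
  exists X : R, forall x : R, X < x -> c * Rpower x e < d.
Proof.
(* Dividing by [c + 1] instead of [c] covers [c = 0]. The threshold below is the solution of
   [x^e = q]. *)
intros Hc He Hd. set (q := d / (c + 1)).
assert (Hq : 0 < q) by (apply Rdiv_lt_0_compat; lra).
exists (exp (ln q / e)). intros x Hx.
assert (L : Rpower x e < q).
{ unfold Rpower. rewrite <- (exp_ln q) by exact Hq. apply exp_increasing.
  assert (ln q / e < ln x).
  { rewrite <- (ln_exp (ln q / e)). apply ln_increasing; [apply exp_pos|exact Hx]. }
  replace (ln q) with (e * (ln q / e)) by (field; lra).
  apply Rmult_lt_gt_compat_neg_l; assumption. }
assert (P : 0 < Rpower x e) by apply exp_pos.
replace d with ((c + 1) * q) by (unfold q; field; lra). nra.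
Qed.

Lemma Rabs_cos_sub_le (x y : R) : Rabs (cos x - cos y) <= Rabs (x - y).
Proof.
destruct (MVT_abs cos (fun z => - sin z) y x) as (c & Hc & _).
- intros c _. apply derivable_pt_lim_cos.
- assert (Rabs (- sin c) <= 1) by (rewrite Rabs_Ropp; apply Rabs_le, SIN_bound).
  pose proof (Rabs_pos (x - y)). nra.
Qed.

(** Interpolation between two bounds: for distance [d < 1] the Lipschitz bound and [d <= d^s], for
    [d >= 1] the trivial bound 2 and [1 <= d^s]. *)
Lemma Rabs_cos_sub_le_Rpower (s x y : R) :
  0 < s <= 1 -> x <> y ->
  Rabs (cos x - cos y) <= 2 * Rpower (Rabs (x - y)) s.
Proof.
intros Hs Hxy. set (d := Rabs (x - y)).
assert (Hd : 0 < d) by (apply Rabs_pos_lt; lra).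
pose proof (Rabs_cos_sub_le x y) as H1. fold d in H1.
destruct (Rle_lt_dec 1 d) as [L|L].
- assert (1 <= Rpower d s).
  { rewrite <- (Rpower_O d) at 1 by exact Hd. apply Rle_Rpower; lra. }
  pose proof (COS_bound x). pose proof (COS_bound y).
  apply Rle_trans with 2; [apply Rabs_le|]; lra.
- assert (d <= Rpower d s).
  { unfold Rpower. rewrite <- (exp_ln d) at 1 by exact Hd.
    assert (ln d < 0) by (rewrite <- ln_1; apply ln_increasing; lra).
    destruct (Req_dec s 1) as [->|E]; [rewrite Rmult_1_l; lra|].
    left. apply exp_increasing. nra. }
  lra.
Qed.

(** * Comparison of series and termwise integration *)

Lemma is_series_single (N : nat) (c : R) :
  is_series (fun n => if Nat.eq_dec n N then c else 0) c.
Proof.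
set (u := fun n => if Nat.eq_dec n N then c else 0).
assert (Z : forall n, (n < N)%nat -> sum_n u n = 0).
{ induction n as [|n IH]; intros Hn.
  - rewrite sum_O. unfold u. destruct Nat.eq_dec; [lia|reflexivity].
  - rewrite sum_Sn, IH by lia. unfold u. destruct Nat.eq_dec; [lia|].
    apply Rplus_0_l. }
assert (E : forall n, sum_n u (n + N) = c).
{ induction n as [|n IH].
  - simpl. assert (HN : u N = c) by (unfold u; destruct Nat.eq_dec; congruence).
    destruct N as [|N]; [rewrite sum_O; exact HN|].
    rewrite sum_Sn, Z, HN by lia. apply Rplus_0_l.
  - simpl. rewrite sum_Sn, IH. unfold u. destruct Nat.eq_dec; [lia|].
    apply Rplus_0_r. }
change (is_lim_seq (sum_n u) c). apply (is_lim_seq_incr_n (sum_n u) N).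
apply is_lim_seq_ext with (fun _ => c); [intros n; symmetry; apply E|].
apply is_lim_seq_const.
Qed.

Lemma ex_series_le_Rabs (b a : nat -> R) :
  ex_series a -> (forall n, Rabs (b n) <= a n) ->
  ex_series (fun n => Rabs (b n)).
Proof.
intros Ha Hb. apply (@ex_series_le R_AbsRing R_CompleteNormedModule _ a).
- intros n. change (Rabs (Rabs (b n)) <= a n). rewrite Rabs_Rabsolu. apply Hb.
- exact Ha.
Qed.

Lemma Rabs_Series_le (b a : nat -> R) (e : R) :
  ex_series a -> (forall n, Rabs (b n) <= e * a n) ->
  Rabs (Series b) <= e * Series a.
Proof.
intros Ha Hb.
assert (Hea : ex_series (fun n => e * a n))
  by exact (@ex_series_scal_l R_AbsRing R_NormedModule e a Ha).
rewrite <- Series_scal_l.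
apply Rle_trans with (1 := Series_Rabs _ (ex_series_le_Rabs b _ Hea Hb)).
apply Series_le; [|exact Hea].
intros n. split; [apply Rabs_pos|apply Hb].
Qed.

(** Subtracting the series whose only nonzero term is [d] at index [N] reduces the estimate to a
    termwise comparison. It serves to single out the resonant prime. *)
Lemma Series_isolated_term (b a : nat -> R) (N : nat) (d e : R) :
  ex_series b -> ex_series a -> Rabs (b N - d) <= e * a N ->
  (forall n, n <> N -> Rabs (b n) <= e * a n) ->
  Rabs (Series b - d) <= e * Series a.
Proof.
intros Hb Ha HN Hn.
pose proof (is_series_single N d) as Hd.
rewrite <- (is_series_unique _ d Hd), <- Series_minus;
  [|exact Hb|exists d; exact Hd].
apply Rabs_Series_le; [exact Ha|].
intros n. simpl. destruct Nat.eq_dec as [->|E]; [exact HN|].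
rewrite Rminus_0_r. apply Hn, E.
Qed.

Lemma is_RInt_sum_n (f : nat -> R -> R) (a b : R) (n : nat) :
  (forall k, ex_RInt (f k) a b) ->
  is_RInt (fun x => sum_n (fun k => f k x) n) a b
    (sum_n (fun k => RInt (f k) a b) n).
Proof.
intros Hf. induction n as [|n IH].
- apply is_RInt_ext with (f O); [intros x _; now rewrite sum_O|].
  rewrite sum_O. apply (RInt_correct (f O)), Hf.
- apply is_RInt_ext with
    (fun x => plus (sum_n (fun k => f k x) n) (f (S n) x)).
  { intros x _. now rewrite sum_Sn. }
  rewrite sum_Sn. apply @is_RInt_plus; [exact IH|].
  apply (RInt_correct (f (S n))), Hf.
Qed.

(** Both sides are tails from index [n + 1]. The right-hand side does not involve [u], which gives
    uniformity when [u] depends on a parameter. *)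
Lemma sum_n_tail_le (u A : nat -> R) (n : nat) :
  ex_series A -> (forall k, Rabs (u k) <= A k) ->
  Rabs (Series u - sum_n u n) <= Series A - sum_n A n.
Proof.
intros HA Hu.
assert (Hus := ex_series_Rabs u (ex_series_le_Rabs u A HA Hu)).
rewrite (Series_incr_n u (S n)), (Series_incr_n A (S n)) by (trivial; lia).
simpl pred. rewrite <- !sum_n_Reals.
match goal with |- Rabs (?x + ?y - ?x) <= ?z + ?w - ?z =>
  replace (x + y - x) with y by ring; replace (z + w - z) with w by ring end.
assert (HA' : ex_series (fun k => A (S n + k)%nat)) by (apply ex_series_incr_n, HA).
rewrite <- (Rmult_1_l (Series (fun k => A _))).
apply Rabs_Series_le; [exact HA'|]. intros k. rewrite Rmult_1_l. apply Hu.
Qed.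

(** Weierstrass M-test: the majorant [A] makes the partial sums converge uniformly in [x], so that
    limit and integral commute. *)
Lemma is_series_RInt (f : nat -> R -> R) (A : nat -> R) (a b : R) :
  ex_series A -> (forall n x, Rabs (f n x) <= A n) ->
  (forall n, ex_RInt (f n) a b) ->
  ex_RInt (fun x => Series (fun n => f n x)) a b /\
  is_series (fun n => RInt (f n) a b)
    (RInt (fun x => Series (fun n => f n x)) a b).
Proof.
intros HA Hf Hi.
destruct (filterlim_RInt (V := R_CompleteNormedModule)
  (fun n x => sum_n (fun k => f k x) n) a b
  eventually eventually_filter (fun x => Series (fun n => f n x))
  (fun n => sum_n (fun k => RInt (f k) a b) n)) as (If & H1 & H2).
- intros n. apply is_RInt_sum_n, Hi.
- apply filterlim_locally. intros eps.
  pose proof (Series_correct _ HA) as HS.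
  pose proof (proj1 (filterlim_locally (F := eventually) (sum_n A) (Series A)) HS eps) as [N HN].
  exists N. intros n Hn x. specialize (HN n Hn).
  change (Rabs (sum_n A n - Series A) < eps) in HN.
  change (Rabs (sum_n (fun k => f k x) n - Series (fun n => f n x)) < eps).
  rewrite Rabs_minus_sym.
  eapply Rle_lt_trans; [apply (sum_n_tail_le _ A); auto|].
  rewrite Rabs_minus_sym in HN.
  eapply Rle_lt_trans; [apply Rle_abs|exact HN].
- split; [exists If; exact H2|].
  rewrite (is_RInt_unique _ _ _ _ H2). exact H1.
Qed.

(** * Fourier decay of the bump *)

(** Real form of the Fourier transform at [mu] of one arch of [cos^(2k)]. The phase [phi] absorbs
    the translation of the bump to [t0]. *)
Definition bump_int (k : nat) (mu phi : R) : R :=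
  RInt (fun u => cos u ^ (2 * k) * cos (mu * u + phi)) (- (PI / 2)) (PI / 2).

Lemma ex_RInt_derivable (f : R -> R) (a b : R) :
  (forall x, ex_derive f x) -> ex_RInt f a b.
Proof.
intros H. apply (@ex_RInt_continuous R_CompleteNormedModule).
intros x _. apply (@ex_derive_continuous R_AbsRing R_NormedModule), H.
Qed.

Lemma ex_RInt_bump (k : nat) (mu phi a b : R) :
  ex_RInt (fun u => cos u ^ (2 * k) * cos (mu * u + phi)) a b.
Proof. apply ex_RInt_derivable. intros x. auto_derive. trivial. Qed.

(* The derivative of [F] below is the difference of the two integrands, and [F]
   vanishes at both endpoints. *)
Lemma bump_int_rec (k : nat) (mu phi : R) :
  (mu ^ 2 - (2 * INR k + 2) ^ 2) * bump_int (S k) mu phi =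
  - ((2 * INR k + 2) * (2 * INR k + 1)) * bump_int k mu phi.
Proof.
set (F := fun u => cos u ^ (2 * k + 1) *
  (mu * cos u * sin (mu * u + phi) - (2 * INR k + 2) * sin u * cos (mu * u + phi))).
set (q := (2 * INR k + 2) * (2 * INR k + 1)).
set (G := fun u => (mu ^ 2 - (2 * INR k + 2) ^ 2) *
    (cos u ^ (2 * S k) * cos (mu * u + phi)) +
  q * (cos u ^ (2 * k) * cos (mu * u + phi))).
assert (D : forall u, is_derive F u (G u)).
{ intros u. unfold F, G, q. auto_derive; [trivial|].
  replace (k + (k + 0) + 1)%nat with (S (2 * k)) by lia.
  replace (2 * S k)%nat with (S (S (2 * k))) by lia.
  rewrite Nat.pred_succ, S_INR, mult_INR. change (INR 2) with 2.
  rewrite <- !tech_pow_Rmult.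
  set (P := cos u ^ (2 * k)). set (X := cos (mu * u + phi)).
  apply Rminus_diag_uniq.
  transitivity ((2 * INR k + 2) * (2 * INR k + 1) * P * X *
    (Rsqr (sin u) + Rsqr (cos u) - 1)); [unfold Rsqr; ring|].
  rewrite sin2_cos2. ring. }
assert (I : is_RInt G (- (PI / 2)) (PI / 2) (F (PI / 2) - F (- (PI / 2)))).
{ apply (@is_RInt_derive R_CompleteNormedModule).
  - intros x _. apply D.
  - intros x _. apply (@ex_derive_continuous R_AbsRing R_NormedModule).
    unfold G. auto_derive. trivial. }
replace (F (PI / 2) - F (- (PI / 2))) with 0 in I
  by (unfold F; rewrite cos_neg, cos_PI2, pow_i by lia; ring).
assert (I' : is_RInt G (- (PI / 2)) (PI / 2)
  ((mu ^ 2 - (2 * INR k + 2) ^ 2) * bump_int (S k) mu phi + q * bump_int k mu phi)).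
{ apply (@is_RInt_plus R_NormedModule);
    apply (@is_RInt_scal R_NormedModule);
    apply (@RInt_correct R_CompleteNormedModule), ex_RInt_bump. }
pose proof (is_RInt_unique _ _ _ _ I) as U.
rewrite (is_RInt_unique _ _ _ _ I') in U. lra.
Qed.

(** Each use of [bump_int_rec] gains a factor [mu^(-2)]. The condition on [mu] stays clear of the
    zeros of the coefficient there: from [4 * (k + 1) <= |mu|] one gets [(2k+2)^2 <= mu^2 / 4], so
    the coefficient is at least [mu^2 / 2]. The constant is uniform in [phi]. *)
Lemma bump_int_decay (k : nat) :
  exists K : R, 0 < K /\ forall mu phi : R, 4 * INR k <= Rabs mu ->
    Rabs mu ^ (2 * k) * Rabs (bump_int k mu phi) <= K.
Proof.
induction k as [|k (K & HK & IH)].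
- exists PI. split; [apply PI_RGT_0|]. intros mu phi _. simpl. rewrite Rmult_1_l.
  replace PI with ((PI / 2 - - (PI / 2)) * 1) by field.
  pose proof PI_RGT_0. apply abs_RInt_le_const; [lra|apply ex_RInt_bump|].
  intros t _. simpl. rewrite Rmult_1_l. apply Rabs_le, COS_bound.
- pose proof (pos_INR k) as Hk.
  exists (2 * ((2 * INR k + 2) * (2 * INR k + 1)) * K). split; [nra|].
  intros mu phi Hmu. rewrite S_INR in Hmu.
  specialize (IH mu phi ltac:(lra)).
  pose proof (bump_int_rec k mu phi) as E. apply (f_equal Rabs) in E.
  rewrite !Rabs_mult, Rabs_Ropp in E.
  assert (S : Rabs mu ^ 2 = mu ^ 2) by apply pow2_abs.
  assert (M : Rabs mu ^ 2 / 2 <= Rabs (mu ^ 2 - (2 * INR k + 2) ^ 2)).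
  { eapply Rle_trans; [|apply Rle_abs]. rewrite <- S. nra. }
  rewrite (Rabs_right (_ * _)) in E by nra.
  replace (2 * Datatypes.S k)%nat with (2 * k + 2)%nat by lia.
  rewrite pow_add.
  assert (P : 0 <= Rabs mu ^ (2 * k)) by (apply pow_le, Rabs_pos).
  pose proof (Rabs_pos (bump_int (Datatypes.S k) mu phi)) as B.
  set (x := Rabs mu ^ (2 * k)) in *.
  set (y := Rabs (bump_int (Datatypes.S k) mu phi)) in *.
  set (q := (2 * INR k + 2) * (2 * INR k + 1)) in *.
  assert (0 < q) by (unfold q; nra).
  apply Rle_trans with (2 * q * (x * Rabs (bump_int k mu phi))); [|nra].
  replace (2 * q * (x * Rabs (bump_int k mu phi)))
    with (2 * x * (q * Rabs (bump_int k mu phi))) by ring.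
  rewrite <- E.
  replace (x * Rabs mu ^ 2 * y) with (2 * x * (Rabs mu ^ 2 / 2 * y)) by field.
  apply Rmult_le_compat_l; [lra|]. apply Rmult_le_compat_r; lra.
Qed.

Lemma bump_int_0_pos (k : nat) : 0 < bump_int k 0 0.
Proof.
pose proof PI_RGT_0. apply RInt_gt_0; [lra| |].
- intros x Hx. rewrite Rmult_0_l, Rplus_0_l, cos_0, Rmult_1_r.
  apply pow_lt, cos_gt_0; lra.
- intros x _. apply (@ex_derive_continuous R_AbsRing R_NormedModule).
  auto_derive. trivial.
Qed.

(** * The coefficients of the series and its Hölder continuity *)

Definition prime_coef (alpha : R) (n : nat) : R :=
  if prime_dec (Z.of_nat n) then Rpower (INR n) (- alpha) else 0.

Lemma prime_coef_nonneg (alpha : R) (n : nat) : 0 <= prime_coef alpha n.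
Proof.
unfold prime_coef. destruct prime_dec; [left; apply exp_pos|lra].
Qed.

(** At [t = 0] every cosine equals 1, so this is the absolute summability of [V_term] there. *)
Lemma ex_series_prime_coef (alpha : R) :
  1 < alpha -> ex_series (prime_coef alpha).
Proof.
intros Ha. apply ex_series_ext with (2 := V_abs_summable alpha 1 0 Ha).
intros n. rewrite <- (Rabs_pos_eq (prime_coef alpha n)) by apply prime_coef_nonneg.
f_equal. unfold V_term, prime_coef. destruct prime_dec; [|reflexivity].
rewrite Rmult_0_r, cos_0. apply Rmult_1_r.
Qed.

Lemma V_term_prime_coef (alpha beta t : R) (n : nat) :
  V_term alpha beta t n =
  prime_coef alpha n * cos (2 * PI * Rpower (INR n) beta * t).
Proof. unfold V_term, prime_coef. destruct prime_dec; ring. Qed.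

Lemma ex_series_V_term (alpha beta t : R) :
  1 < alpha -> ex_series (V_term alpha beta t).
Proof. intros Ha. apply ex_series_Rabs, V_abs_summable, Ha. Qed.

Lemma Cmod_V_sub (alpha beta x y : R) :
  1 < alpha ->
  Cmod (Cminus (V alpha beta x) (V alpha beta y)) =
  Rabs (Series (fun n => V_term alpha beta x n - V_term alpha beta y n)).
Proof.
intros Ha. unfold V. rewrite <- RtoC_minus, Cmod_R, Series_minus;
  trivial; now apply ex_series_V_term.
Qed.

(** By interpolation the [n]-th term is [s]-Hölder with a constant of order [n^(beta * s - alpha)],
    and these constants are summable. *)
Lemma V_holder_at (alpha beta s t0 : R) :
  0 < s <= 1 -> 0 < beta -> 1 < alpha - beta * s ->
  holder_at (V alpha beta) t0 s.
Proof.
intros Hs Hb Has.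
set (c := 2 * Rpower (2 * PI) s). set (S := Series (prime_coef (alpha - beta * s))).
assert (HS := Rle_abs S).
assert (Hc : 0 < c) by (unfold c; pose proof (exp_pos (s * ln (2 * PI))); unfold Rpower; lra).
(* The absolute value and the added 1 make the constant visibly positive. The estimate is global, so
   the radius 1 is arbitrary. *)
exists (c * Rabs S + 1), 1. split; [pose proof (Rabs_pos S); nra|]. split; [lra|]. intros x y _ _.
assert (bs : 0 < beta * s) by nra.
rewrite Cmod_V_sub by lra.
set (r := Rpower (Rabs (x - y)) s). assert (Hr : 0 < r) by apply exp_pos.
assert (T : forall n, Rabs (V_term alpha beta x n - V_term alpha beta y n) <=
  c * r * prime_coef (alpha - beta * s) n).
{ intros n. rewrite !V_term_prime_coef, <- Rmult_minus_distr_l, Rabs_mult.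
  rewrite Rabs_pos_eq by apply prime_coef_nonneg.
  unfold prime_coef. destruct prime_dec as [Hp|_]; [|lra].
  assert (Hn : 0 < INR n) by (apply lt_0_INR; destruct Hp; lia).
  replace (- (alpha - beta * s)) with (- alpha + beta * s) by ring.
  rewrite Rpower_plus.
  destruct (Req_dec x y) as [<-|E].
  { rewrite Rminus_diag, Rabs_R0, Rmult_0_r.
    repeat apply Rmult_le_pos; try lra; left; apply exp_pos. }
  pose proof PI_RGT_0 as HPI.
  assert (Hw : 0 < Rpower (INR n) beta) by apply exp_pos.
  set (w := 2 * PI * Rpower (INR n) beta).
  assert (w0 : 0 < w) by (unfold w; nra).
  assert (L : Rabs (cos (w * x) - cos (w * y)) <=
    2 * Rpower (Rabs (w * x - w * y)) s) by (apply Rabs_cos_sub_le_Rpower; nra).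
  rewrite <- Rmult_minus_distr_l, Rabs_mult, (Rabs_pos_eq w) in L by lra.
  rewrite <- Rpower_mult_distr in L by (trivial; apply Rabs_pos_lt; lra).
  unfold w at 3 in L. rewrite <- Rpower_mult_distr, Rpower_mult in L by lra.
  apply Rle_trans with (Rpower (INR n) (- alpha) *
    (2 * (Rpower (2 * PI) s * Rpower (INR n) (beta * s) * Rpower (Rabs (x - y)) s))).
  - apply Rmult_le_compat_l; [left; apply exp_pos|exact L].
  - unfold c, r. right. ring. }
pose proof (Rabs_Series_le _ _ (c * r) (ex_series_prime_coef _ Has) T) as I.
fold S in I. pose proof (Rmult_le_pos (c * r) (Rabs S - S) ltac:(nra) ltac:(lra)). nra.
Qed.

(** * The upper bound for the exponent *)

(* [h] is chosen so that [w N * h / 2 = PI / 2]: by [cos_plus], the [n]-th term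
   of the increment carries a factor [sin (w n * h / 2)], which is 1 at [n = N]. *)
Lemma V_increment_projection (alpha beta t0 kappa K : R) (k N : nat) :
  1 < alpha -> 1 <= beta -> 0 < kappa ->
  (1 <= N)%nat ->
  (forall mu phi : R, 4 * INR k <= Rabs mu ->
    Rabs mu ^ (2 * k) * Rabs (bump_int k mu phi) <= K) ->
  let w n := 2 * PI * Rpower (INR n) beta in
  let h := / (2 * Rpower (INR N) beta) in
  let m := kappa * (2 * PI * Rpower (INR N) (beta - 1)) in
  let g u := Series (fun n => cos u ^ (2 * k) *
     ((V_term alpha beta (t0 + kappa * u + h / 2) n
       - V_term alpha beta (t0 + kappa * u - h / 2) n)
      * sin (w N * (t0 + kappa * u)))) in
  4 * INR k <= m ->
  ex_RInt g (- (PI / 2)) (PI / 2) /\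
  Rabs (RInt g (- (PI / 2)) (PI / 2) + prime_coef alpha N * bump_int k 0 0)
  <= 2 * (K / m ^ (2 * k)) * Series (prime_coef alpha).
Proof.
intros Ha Hb Hkap HN Hdecay w h m g Hm.
pose proof PI_RGT_0 as HPI.
assert (HN0 : 0 < INR N) by (apply lt_0_INR; lia).
assert (Hm0 : 0 < m).
{ unfold m. do 2 (apply Rmult_lt_0_compat; [lra|]). apply exp_pos. }
(* [m] is the frequency gap around [w N] after dilation by [kappa]; every integral except the
   resonant one has a frequency of at least this size. *)
assert (J : forall mu phi, m <= Rabs mu ->
  Rabs (bump_int k mu phi) <= K / m ^ (2 * k)).
{ intros mu phi Hmu.
  assert (0 < m ^ (2 * k)) by (apply pow_lt, Hm0).
  apply Rmult_le_reg_l with (m ^ (2 * k)); [assumption|].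
  replace (m ^ (2 * k) * (K / m ^ (2 * k))) with K by (field; lra).
  apply Rle_trans with (2 := Hdecay mu phi ltac:(lra)).
  apply Rmult_le_compat_r; [apply Rabs_pos|]. apply pow_incr. lra. }
assert (Hw : forall n, 0 < w n).
{ intros n. unfold w. apply Rmult_lt_0_compat; [lra|]. apply exp_pos. }
set (dif n := kappa * (w n - w N)). set (sm n := kappa * (w n + w N)).
set (f n u := cos u ^ (2 * k) *
     ((V_term alpha beta (t0 + kappa * u + h / 2) n
       - V_term alpha beta (t0 + kappa * u - h / 2) n)
      * sin (w N * (t0 + kappa * u)))).
set (b n := prime_coef alpha n * sin (w n * h / 2)).
(* Product-to-sum: [cos (x + z) - cos (x - z)] is [-2 sin x sin z], and [-2 sin x sin y] is
   [cos (x + y) - cos (x - y)]. Each term thus splits into a sum and a difference frequency. *)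
assert (Hf : forall n u, f n u =
  b n * (cos u ^ (2 * k) * cos (sm n * u + (w n + w N) * t0)) -
  b n * (cos u ^ (2 * k) * cos (dif n * u + (w n - w N) * t0))).
{ intros n u. unfold f, b. rewrite !V_term_prime_coef. fold (w n).
  set (x := w n * (t0 + kappa * u)). set (y := w N * (t0 + kappa * u)).
  set (z := w n * h / 2).
  replace (w n * (t0 + kappa * u + h / 2)) with (x + z) by (unfold x, z; field).
  replace (w n * (t0 + kappa * u - h / 2)) with (x - z) by (unfold x, z; field).
  replace (sm n * u + (w n + w N) * t0) with (x + y) by (unfold x, y, sm; ring).
  replace (dif n * u + (w n - w N) * t0) with (x - y) by (unfold x, y, dif; ring).
  rewrite !cos_plus, !cos_minus. ring. }
assert (Hint : forall n, is_RInt (f n) (- (PI / 2)) (PI / 2)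
  (b n * (bump_int k (sm n) ((w n + w N) * t0)
          - bump_int k (dif n) ((w n - w N) * t0)))).
{ intros n. rewrite Rmult_minus_distr_l.
  apply is_RInt_ext with (fun u =>
    b n * (cos u ^ (2 * k) * cos (sm n * u + (w n + w N) * t0)) -
    b n * (cos u ^ (2 * k) * cos (dif n * u + (w n - w N) * t0))).
  { intros u _. symmetry. apply Hf. }
  apply (@is_RInt_minus R_NormedModule);
    apply (@is_RInt_scal R_NormedModule);
    apply (@RInt_correct R_CompleteNormedModule), ex_RInt_bump. }
assert (Hsm : forall n, m <= Rabs (sm n)).
{ intros n. eapply Rle_trans; [|apply Rle_abs].
  unfold m, sm. apply Rmult_le_compat_l; [lra|].
  apply Rle_trans with (w N); [|specialize (Hw n); lra].
  unfold w. apply Rmult_le_compat_l; [lra|]. apply Rle_Rpower; [|lra].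
  apply (le_INR 1), HN. }
assert (HKm : 0 <= K / m ^ (2 * k)).
{ apply Rle_trans with (2 := J _ 0 (Hsm N)), Rabs_pos. }
assert (HA : ex_series (fun n => 2 * prime_coef alpha n)).
{ exact (@ex_series_scal_l R_AbsRing R_NormedModule 2 _ (ex_series_prime_coef _ Ha)). }
assert (Hbn : forall n, Rabs (b n) <= prime_coef alpha n).
{ intros n. unfold b. pose proof (prime_coef_nonneg alpha n) as P.
  rewrite Rabs_mult, Rabs_pos_eq by exact P.
  assert (Rabs (sin (w n * h / 2)) <= 1) by apply Rabs_le, SIN_bound. nra. }
assert (C1 : forall u z, Rabs (cos u ^ (2 * k) * cos z) <= 1).
{ intros u z. rewrite Rabs_mult, <- RPow_abs, <- (Rmult_1_l 1).
  apply Rmult_le_compat; try apply Rabs_pos; [apply pow_le, Rabs_pos| |].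
  - rewrite <- (pow1 (2 * k)). apply pow_incr.
    split; [apply Rabs_pos|apply Rabs_le, COS_bound].
  - apply Rabs_le, COS_bound. }
destruct (is_series_RInt f (fun n => 2 * prime_coef alpha n)
  (- (PI / 2)) (PI / 2) HA) as [E1 E2].
{ intros n u. rewrite Hf, <- Rmult_minus_distr_l, Rabs_mult, Rmult_comm.
  apply Rmult_le_compat; try apply Rabs_pos; [|apply Hbn].
  eapply Rle_trans; [apply Rabs_triang|]. rewrite Rabs_Ropp.
  apply Rplus_le_compat; apply C1. }
{ intros n. eexists. apply Hint. }
split; [exact E1|]. fold g in E2.
change (fun u => Series (fun n => f n u)) with g in E2.
rewrite <- (is_series_unique _ _ E2).
replace (Series _ + _) with (Series (fun n => RInt (f n) (- (PI / 2)) (PI / 2))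
  - - (prime_coef alpha N * bump_int k 0 0)) by ring.
apply Series_isolated_term with N.
- eexists. exact E2.
- apply ex_series_prime_coef, Ha.
- rewrite (is_RInt_unique _ _ _ _ (Hint N)).
  assert (B : b N = prime_coef alpha N).
  { unfold b. replace (w N * h / 2) with (PI / 2); [rewrite sin_PI2; ring|].
    unfold w, h. field. pose proof (exp_pos (beta * ln (INR N))). unfold Rpower. lra. }
  (* At [n = N] the difference frequency and its phase vanish, so its integral cancels against the
     isolated value; only the sum frequency is left to bound. *)
  rewrite B. unfold dif. rewrite !Rminus_diag, Rmult_0_r, Rmult_0_l.
  match goal with |- Rabs ?x <= _ => replace x with
    (prime_coef alpha N * bump_int k (sm N) ((w N + w N) * t0)) by ring end.
  rewrite Rabs_mult, Rabs_pos_eq, Rmult_comm by apply prime_coef_nonneg.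
  apply Rmult_le_compat_r; [apply prime_coef_nonneg|].
  apply Rle_trans with (1 := J _ _ (Hsm N)). lra.
- intros n Hn. rewrite (is_RInt_unique _ _ _ _ (Hint n)), Rabs_mult.
  pose proof (Hbn n) as Bn.
  (* Primality supplies [1 <= n] for the frequency gap; at the other indices, 0 included, the
     coefficient is zero. *)
  destruct (prime_dec (Z.of_nat n)) as [Hp|Hp].
  + assert (D : m <= Rabs (dif n)).
    { unfold dif, m, w.
      rewrite <- Rmult_minus_distr_l, !Rabs_mult, !(Rabs_pos_eq _) by lra.
      repeat (apply Rmult_le_compat_l; [lra|]).
      apply Rpower_gap; trivial. destruct Hp; lia. }
    rewrite Rmult_comm. apply Rmult_le_compat; try apply Rabs_pos; [|exact Bn].
    eapply Rle_trans; [apply Rabs_triang|]. rewrite Rabs_Ropp.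
    pose proof (J _ ((w n + w N) * t0) (Hsm n)).
    pose proof (J _ ((w n - w N) * t0) D). lra.
  + assert (Z : prime_coef alpha n = 0).
    { unfold prime_coef. destruct prime_dec; tauto. }
    rewrite Z in Bn |- *. pose proof (Rabs_pos (b n)).
    replace (Rabs (b n)) with 0 by lra. lra.
Qed.

Lemma V_holder_exponent_le (alpha beta t0 s : R) :
  1 < alpha -> 1 < beta -> 0 < s -> holder_at (V alpha beta) t0 s ->
  s <= alpha / beta.
Proof.
intros Ha Hb Hs (H & eps & HH & Heps & Hold).
destruct (Rle_lt_dec s (alpha / beta)) as [L|L]; [exact L|exfalso].
assert (Hsab : alpha - beta * s < 0).
{ apply (Rmult_lt_compat_l beta) in L; [|lra].
  replace (beta * (alpha / beta)) with alpha in L by (field; lra). lra. }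
pose proof PI_RGT_0 as HPI. pose proof PI_4 as HPI4.
(* This [k] makes the error [N^(-2k(beta-1))] negligible against the main term [N^(-alpha)]. *)
destruct (INR_unbounded (alpha / (beta - 1))) as [k Hk].
assert (Hk' : alpha - (beta - 1) * INR (2 * k) < 0).
{ rewrite mult_INR. change (INR 2) with 2.
  apply (Rmult_lt_compat_l (beta - 1)) in Hk; [|lra].
  replace ((beta - 1) * (alpha / (beta - 1))) with alpha in Hk by (field; lra).
  lra. }
destruct (bump_int_decay k) as (K & HK & Hdecay).
pose proof (bump_int_0_pos k) as Hc0. set (c0 := bump_int k 0 0) in *.
(* Since [|u| <= PI / 2 <= 2], the shift [kappa * u] is at most [eps / 2], which leaves room for
   [h / 2]. The constant [q] is the part of [m ^ (2 * k)] independent of [N]. *)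
set (kappa := eps / 4). set (q := (kappa * (2 * PI)) ^ (2 * k)).
assert (Hkap : 0 < kappa) by (unfold kappa; lra).
assert (Hkpi : 0 < kappa * (2 * PI)) by (apply Rmult_lt_0_compat; lra).
assert (Hq : 0 < q) by (apply pow_lt, Hkpi).
set (S := Series (prime_coef alpha)). assert (HS := Rle_abs S).
assert (HS0 := Rabs_pos S).
assert (Hq' : 0 < / q) by (apply Rinv_0_lt_compat, Hq).
(* Four thresholds for [N]: after multiplication by [N^alpha], [X1] and [X2] put the Hölder bound
   and the error each below half of [c0]; [X3] gives [4 * k <= m], and [X4] gives [h < eps]. *)
destruct (Rpower_neg_eventually_small (PI * H) (alpha - beta * s) (c0 / 2))
  as [X1 HX1]; [nra|lra|lra|].
destruct (Rpower_neg_eventually_small (2 * K * Rabs S * / q)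
  (alpha - (beta - 1) * INR (2 * k)) (c0 / 2)) as [X2 HX2].
{ apply Rmult_le_pos; [apply Rmult_le_pos|]; lra. } { lra. } { lra. }
destruct (Rpower_neg_eventually_small (4 * INR k) (- (beta - 1)) (kappa * (2 * PI)))
  as [X3 HX3]; [pose proof (pos_INR k); lra|lra|lra|].
destruct (Rpower_neg_eventually_small 1 (- beta) eps) as [X4 HX4]; [lra|lra|lra|].
destruct (INR_unbounded (Rmax (Rmax X1 X2) (Rmax X3 X4))) as [M HM].
destruct (exists_prime_above M) as (N & HNp & HNM).
assert (HN : Rmax (Rmax X1 X2) (Rmax X3 X4) < INR N)
  by (apply lt_INR in HNM; lra).
apply Rmax_Rlt in HN as [HN1 HN2].
apply Rmax_Rlt in HN1 as [N1 N2]. apply Rmax_Rlt in HN2 as [N3 N4].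
specialize (HX1 _ N1). specialize (HX2 _ N2).
specialize (HX3 _ N3). specialize (HX4 _ N4).
assert (Npos : (1 <= N)%nat) by lia.
set (x := INR N) in *. assert (Hx : 0 < x) by (apply lt_0_INR; lia).
pose proof (V_increment_projection alpha beta t0 kappa K k N Ha ltac:(lra)
  Hkap Npos Hdecay) as P. cbv zeta in P. fold x c0 S in P.
set (h := / (2 * Rpower x beta)) in *.
set (m := kappa * (2 * PI * Rpower x (beta - 1))) in *.
assert (Hxb : 0 < Rpower x beta) by apply exp_pos.
assert (Hh : 0 < h) by (apply Rinv_0_lt_compat; lra).
assert (Hhx : h <= Rpower x (- beta)).
{ rewrite Rpower_Ropp. apply Rinv_le_contravar; lra. }
destruct P as [P1 P2].
{ unfold m. rewrite Rpower_Ropp in HX3.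
  assert (Y : 0 < Rpower x (beta - 1)) by apply exp_pos.
  apply (Rmult_lt_compat_r _ _ _ Y) in HX3.
  replace (4 * INR k * / Rpower x (beta - 1) * Rpower x (beta - 1))
    with (4 * INR k) in HX3 by (field; lra). lra. }
match type of P1 with ex_RInt ?G _ _ => set (g := G) in * end.
assert (B : Rabs (RInt g (- (PI / 2)) (PI / 2)) <= PI * (H * Rpower x (- (beta * s)))).
{ replace PI with (PI / 2 - - (PI / 2)) at 3 by field.
  apply abs_RInt_le_const; [lra|exact P1|]. intros u Hu.
  (* The bump and the sine leave the series, and what remains is an increment of [V] over a step of
     length [h], to which the Hölder condition applies. *)
  unfold g. rewrite Series_scal_l, Series_scal_r, !Rabs_mult.
  assert (Ku : Rabs (kappa * u) <= eps / 2).
  { rewrite Rabs_mult, Rabs_pos_eq by lra.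
    assert (Rabs u <= 2) by (apply Rabs_le; lra). unfold kappa. nra. }
  apply Rabs_le_between in Ku.
  pose proof (Hold (t0 + kappa * u + h / 2) (t0 + kappa * u - h / 2)
    ltac:(apply Rabs_def1; lra) ltac:(apply Rabs_def1; lra)) as O.
  rewrite Cmod_V_sub in O by exact Ha.
  replace (t0 + kappa * u + h / 2 - (t0 + kappa * u - h / 2)) with h in O by field.
  rewrite (Rabs_pos_eq h) in O by lra.
  assert (O' : Rpower h s <= Rpower x (- (beta * s))).
  { replace (- (beta * s)) with (- beta * s) by ring. rewrite <- Rpower_mult.
    apply Rle_Rpower_l; lra. }
  assert (C : Rabs (cos u ^ (2 * k)) <= 1).
  { rewrite <- RPow_abs, <- (pow1 (2 * k)). apply pow_incr.
    split; [apply Rabs_pos|apply Rabs_le, COS_bound]. }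
  match goal with |- _ * (?p * Rabs (sin ?z)) <= _ =>
    assert (D : Rabs (sin z) <= 1) by apply Rabs_le, SIN_bound;
    assert (D0 := Rabs_pos (sin z));
    assert (p0 : 0 <= p) by apply Rabs_pos;
    apply Rle_trans with (1 * (p * 1)) end.
  - apply Rmult_le_compat; try apply Rabs_pos; [|exact C|].
    + apply Rmult_le_pos; lra.
    + apply Rmult_le_compat_l; lra.
  - nra. }
assert (Hc : prime_coef alpha N = Rpower x (- alpha)).
{ unfold prime_coef. destruct prime_dec; [reflexivity|contradiction]. }
rewrite Hc in P2.
assert (Hm : / m ^ (2 * k) = / q * Rpower x (- ((beta - 1) * INR (2 * k)))).
{ rewrite Rpower_Ropp, <- Rpower_mult, Rpower_pow by apply exp_pos.
  unfold m, q. rewrite <- Rinv_mult, <- Rpow_mult_distr. do 2 f_equal. ring. }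
assert (F : Rpower x (- alpha) * c0 <= PI * (H * Rpower x (- (beta * s))) +
  2 * K * Rabs S * / q * Rpower x (- ((beta - 1) * INR (2 * k)))).
{ set (I := RInt g (- (PI / 2)) (PI / 2)) in *.
  set (r := Rpower x (- alpha) * c0) in *.
  assert (2 * (K / m ^ (2 * k)) * S <=
    2 * K * Rabs S * / q * Rpower x (- ((beta - 1) * INR (2 * k)))).
  { unfold Rdiv. rewrite Hm.
    set (y := Rpower x (- ((beta - 1) * INR (2 * k)))).
    assert (0 < y) by apply exp_pos.
    replace (2 * (K * (/ q * y)) * S) with (2 * K * / q * y * S) by ring.
    replace (2 * K * Rabs S * / q * y) with (2 * K * / q * y * Rabs S) by ring.
    apply Rmult_le_compat_l; [|exact HS].
    repeat (apply Rmult_le_pos; [|lra]); lra. }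
  apply Rabs_le_between in P2. apply Rabs_le_between in B. lra. }
assert (Hxa : 0 < Rpower x alpha) by apply exp_pos.
(* After this scaling the left side is the constant [c0], while the right side is a sum of two terms
   each below [c0 / 2]. *)
apply (Rmult_le_compat_l (Rpower x alpha)) in F; [|lra].
assert (E : Rpower x alpha * Rpower x (- alpha) = 1).
{ rewrite <- Rpower_plus, Rplus_opp_r. apply Rpower_O, Hx. }
unfold Rminus in HX1. unfold Rminus at 1 in HX2.
rewrite Rpower_plus in HX1, HX2.
rewrite <- Rmult_assoc, E, Rmult_1_l in F. lra.
Qed.

Theorem theorem4 (alpha beta : R)
  (hbeta : 0 < beta) (halpha : 1 < alpha) (hab : alpha <= beta + 1) :
  forall t0 : R,
    locally_holder (V alpha beta) t0 /\
    Rbar_le (local_holder_exponent (V alpha beta) t0) (Finite (alpha / beta)).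
Proof.
intros t0. split.
(* Half of the critical value [(alpha - 1) / beta], capped at 1: then
   [alpha - beta * s >= (alpha + 1) / 2 > 1]. *)
- set (s := Rmin 1 ((alpha - 1) / (2 * beta))).
  assert (Hs : 0 < s <= 1).
  { split; [|apply Rmin_l]. apply Rmin_pos; [lra|apply Rdiv_lt_0_compat; lra]. }
  exists s. split; [exact Hs|]. apply V_holder_at; [exact Hs|exact hbeta|].
  assert (L : beta * s <= beta * ((alpha - 1) / (2 * beta)))
    by (apply Rmult_le_compat_l; [lra|apply Rmin_r]).
  replace (beta * ((alpha - 1) / (2 * beta))) with ((alpha - 1) / 2) in L
    by (field; lra). lra.
- apply Lub_Rbar_correct. intros s [Hs Hh]. simpl.
  destruct (Rle_lt_dec beta alpha) as [L|L].
  + apply Rle_trans with 1; [lra|]. apply Rle_div_r; lra.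
  + apply V_holder_exponent_le with t0; trivial; lra.
Qed.
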